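(* A finite universe of separations $\vec U$ has a graphic implementation if and only if $\vec U$ is distributive and the set $\mathrm{Small}(\vec U)$ of small elements of $\vec U$, with the order induced from $\vec U$, is a boolean algebra whose maximal element is degenerate in $\vec U$.
   Context: A separation system is a poset with an order-reversing involution $\vec s\mapsto\vec s^{\,*}$; a universe of separations is a separation system which is a lattice, with join $\vee$ and meet $\wedge$; it is distributive if this lattice is distributive. An element $\vec s$ is small if $\vec s\le\vec s^{\,*}$ and degenerate if $\vec s=\vec s^{\,*}$. An isomorphism of universes is a bijection commuting with involutions, joins and meets whose inverse also does so. For a set $V$, $\mathcal{U}(V)$ is the universe of all pairs $(A,B)$ of subsets of $V$ with $A\cup B=V$, with involution $(A,B)^*=(B,A)$, order $(A,B)\le(C,D)$ iff $A\subseteq C$ and $D\subseteq B$, join $(A\cup C,B\cap D)$ and meet $(A\cap C,B\cup D)$. For an undirected graph $G=(V,E)$, $\mathcal{U}(G)$ is the sub-universe of $\mathcal{U}(V)$ consisting of all $(A,B)$ such that $G$ has no edge between a vertex of $A\setminus B$ and a vertex of $B\setminus A$. A universe $\vec U$ has a graphic implementation if there is a graph $G$ such that $\mathcal{U}(G)$ is isomorphic (as a universe) to $\vec U$ itself. *)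

(* Defs.v *)
From HB Require Import structures.
From mathcomp Require Import all_boot all_order.
From mathcomp Require Import boolp classical_sets.

Set Implicit Arguments.
Unset Strict Implicit.
Unset Printing Implicit Defensive.

Import Order.TTheory.
Local Open Scope order_scope.

HB.mixin Record hasSepInvolution d T of Order.POrder d T := {
  sinv : T -> T;
  sinvK : involutive sinv;
  le_sinv : forall x y : T, x <= y -> sinv y <= sinv x
}.

#[short(type="sepSystemType")]
HB.structure Definition SepSystem d :=
  { T of hasSepInvolution d T & Order.POrder d T }.

#[short(type="universeType")]
HB.structure Definition Universe d := { T of SepSystem d T & Order.Lattice d T }.

#[short(type="finUniverseType")]
HB.structure Definition FinUniverse d :=
  { T of Universe d T & Order.FinLattice d T }.

Definition small d (S : sepSystemType d) (s : S) : bool := s <= sinv s.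

Definition degenerate d (S : sepSystemType d) (s : S) : Prop := s = sinv s.

Definition distributive_universe d (U : universeType d) : Prop :=
  left_distributive (@Order.meet d U) (@Order.join d U).

Definition universe_morphism d d' (U : universeType d) (U' : universeType d')
    (f : U -> U') : Prop :=
  [/\ {morph f : x / sinv x},
      {morph f : x y / x `|` y} &
      {morph f : x y / x `&` y}].

Definition universe_isomorphic d d' (U : universeType d) (U' : universeType d')
    : Prop :=
  exists (f : U -> U') (g : U' -> U),
    [/\ cancel f g, cancel g f, universe_morphism f & universe_morphism g].

(* The set Small(U), as a type carrying the order induced from U. *)
Record Small d (S : sepSystemType d) :=
  MkSmall { small_val :> S; small_valP : small small_val }.

HB.instance Definition _ d (S : sepSystemType d) :=
  [isSub for @small_val d S].
HB.instance Definition _ d (S : sepSystemType d) :=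
  [Choice of Small S by <:].
HB.instance Definition _ d (S : sepSystemType d) :=
  [SubChoice_isSubPOrder of Small S by <: with d].

(* A poset is a boolean algebra if its order is that of a complemented
   distributive lattice with bottom and top. The one-element algebra is
   allowed: it is Small(U(G)) for the graph G without vertices. *)
Definition boolean_algebra d (P : porderType d) : Prop :=
  exists (d' : Order.disp_t) (B : ctbDistrLatticeType d') (f : P -> B),
    bijective f /\ {mono f : x y / x <= y}.

Definition greatest d (P : porderType d) (m : P) : Prop := forall x : P, x <= m.

(* V is an arbitrary type, so V may be empty or infinite. *)
Record setSep (V : Type) := SetSep {
  sides :> set V * set V;
  sidesP : `[< (sides.1 `|` sides.2)%classic = setT >]
}.

HB.instance Definition _ V := [isSub for @sides V].
HB.instance Definition _ V := [Choice of setSep V by <:].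

Fact sep_display : Order.disp_t. Proof. exact: Order.Disp tt tt. Qed.

Section SetSepUniverse.
Variable V : Type.
Implicit Types s t : setSep V.

Lemma sepUT s : (s.1 `|` s.2)%classic = setT.
Proof. exact/asboolP/(sidesP s). Qed.

Definition setSep_le s t : bool :=
  `[< (s.1 `<=` t.1)%classic /\ (t.2 `<=` s.2)%classic >].

Fact setSep_le_refl : reflexive setSep_le.
Proof. by move=> s; apply/asboolP; split. Qed.

Fact setSep_le_anti : antisymmetric setSep_le.
Proof.
move=> s t /andP[/asboolP[s1 s2] /asboolP[t1 t2]]; apply: val_inj => /=.
move: s1 s2 t1 t2; case: (sides s) (sides t) => [A B] [C D] /= AC DB CA BD.
by congr pair; apply/seteqP; split.
Qed.

Fact setSep_le_trans : transitive setSep_le.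
Proof.
move=> t s u /asboolP[s1 s2] /asboolP[t1 t2]; apply/asboolP; split.
  exact: subset_trans s1 t1.
exact: subset_trans t2 s2.
Qed.

HB.instance Definition _ := Order.Le_isPOrder.Build sep_display (setSep V)
  setSep_le_refl setSep_le_anti setSep_le_trans.

Fact setSep_inv_subproof s : `[< (s.2 `|` s.1)%classic = setT >].
Proof. by apply/asboolP; rewrite setUC sepUT. Qed.
Definition setSep_inv s : setSep V :=
  @SetSep V (s.2, s.1) (setSep_inv_subproof s).

Fact setSep_join_subproof s t :
  `[< ((s.1 `|` t.1) `|` (s.2 `&` t.2))%classic = setT >].
Proof.
apply/asboolP; rewrite setUIr setUAC sepUT setTU setTI.
by rewrite -setUA sepUT setUT.
Qed.
Definition setSep_join s t : setSep V :=
  @SetSep V ((s.1 `|` t.1)%classic, (s.2 `&` t.2)%classic)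
    (setSep_join_subproof s t).

Fact setSep_meet_subproof s t :
  `[< ((s.1 `&` t.1) `|` (s.2 `|` t.2))%classic = setT >].
Proof.
apply/asboolP; rewrite setUIl setUA sepUT setTU setTI.
by rewrite setUCA sepUT setUT.
Qed.
Definition setSep_meet s t : setSep V :=
  @SetSep V ((s.1 `&` t.1)%classic, (s.2 `|` t.2)%classic)
    (setSep_meet_subproof s t).

Fact setSep_lexI s t u :
  (s <= setSep_meet t u) = (s <= t) && (s <= u).
Proof.
apply/asboolP/andP => /= [[]|[/asboolP[? ?] /asboolP[? ?]]].
  by rewrite subsetI subUset => -[? ?] [? ?]; split; apply/asboolP.
by rewrite subsetI subUset.
Qed.

Fact setSep_leUx s t u :
  (setSep_join s t <= u) = (s <= u) && (t <= u).
Proof.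
apply/asboolP/andP => /= [[]|[/asboolP[? ?] /asboolP[? ?]]].
  by rewrite subsetI subUset => -[? ?] [? ?]; split; apply/asboolP.
by rewrite subsetI subUset.
Qed.

HB.instance Definition _ :=
  Order.POrder_MeetJoin_isLattice.Build sep_display (setSep V)
    setSep_lexI setSep_leUx.

Fact setSep_invK : involutive setSep_inv.
Proof. by move=> s; apply: val_inj => /=; case: (sides s). Qed.

Fact setSep_le_inv s t : s <= t -> setSep_inv t <= setSep_inv s.
Proof. by move=> /asboolP[? ?]; apply/asboolP; split. Qed.

HB.instance Definition _ :=
  hasSepInvolution.Build sep_display (setSep V) setSep_invK setSep_le_inv.

End SetSepUniverse.

Record graph := Graph {
  vertex :> Type;
  edge : vertex -> vertex -> Prop;
  edge_sym : forall x y, edge x y -> edge y x;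
  edge_irrefl : forall x, ~ edge x x
}.

Definition separates (G : graph) : pred (setSep G) := fun s =>
  `[< forall x y : G,
      (s.1 `\` s.2)%classic x -> (s.2 `\` s.1)%classic y -> ~ edge x y >].

Record graphSep (G : graph) :=
  GraphSep { gsep :> setSep G; gsepP : separates gsep }.

HB.instance Definition _ G := [isSub for @gsep G].
HB.instance Definition _ G := [Choice of graphSep G by <:].

Section GraphSepUniverse.
Variable G : graph.

Fact separates_inv (s : setSep G) : separates s -> separates (sinv s).
Proof.
move=> /asboolP Hs; apply/asboolP => x y /= Hx Hy /edge_sym.
exact: Hs.
Qed.

Fact separates_meet : {in @separates G &, forall s t, s `&` t \in @separates G}.
Proof.
move=> s t /asboolP Hs /asboolP Ht; apply/asboolP => x y /=.
move=> [[sx tx] /not_orP[nsx ntx]] [sty /not_andP nsty].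
have side (u : setSep G) z : ~ u.1 z -> u.2 z.
  have : (u.1 `|` u.2)%classic z by rewrite sepUT.
  by case.
case: nsty => ny; first by apply: (Hs x y); split => //; apply: side.
by apply: (Ht x y); split => //; apply: side.
Qed.

Fact separates_join : {in @separates G &, forall s t, s `|` t \in @separates G}.
Proof.
have joinE (s t : setSep G) : s `|` t = sinv (sinv s `&` sinv t).
  by apply: val_inj.
move=> s t Hs Ht; rewrite joinE.
by apply: separates_inv; apply: separates_meet; apply: separates_inv.
Qed.

HB.instance Definition _ :=
  Order.isLatticeClosed.Build sep_display (setSep G) (@separates G)
    separates_meet separates_join.
HB.instance Definition _ :=
  [SubChoice_isSubLattice of graphSep G by <: with sep_display].

Definition graphSep_inv (s : graphSep G) : graphSep G :=
  GraphSep (separates_inv (gsepP s)).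

Fact graphSep_invK : involutive graphSep_inv.
Proof. by move=> s; apply: val_inj; rewrite /= sinvK. Qed.

Fact graphSep_le_inv (s t : graphSep G) :
  s <= t -> graphSep_inv t <= graphSep_inv s.
Proof. exact: le_sinv. Qed.

HB.instance Definition _ :=
  hasSepInvolution.Build sep_display (graphSep G)
    graphSep_invK graphSep_le_inv.

End GraphSepUniverse.

Definition graphic_implementation d (U : universeType d) : Prop :=
  exists G : graph, universe_isomorphic (graphSep G) U.

(* Main.v *)
Require Import Defs.
From mathcomp Require Import all_boot all_order.
From mathcomp Require Import boolp classical_sets.

(** The degenerate top [m] of [Small U] satisfies [x <= m] iff [x] is small, so
    [Small U] is the interval below [m].  Let [V] be its set of atoms and send
    [u] to [(A u, B u)], the atoms below [u] and below its inverse.  Since [u /\ u*]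
    is small, [m <= u \/ u*]; atoms being join-prime, [A u] and [B u] cover [V]
    and [u |-> (A u, B u)] is a morphism.  It is injective because [u] is
    determined by [u /\ m] and [u \/ m = (u* /\ m)*], and elements below [m] are
    determined by the atoms below them.  Let two atoms [x], [y] be adjacent when
    no [u] has [x] in [A u \ B u] and [y] in [B u \ A u].  The image then is all
    of U(G): for [(A, B)] in U(G), the largest [u] mapped below [(A, B)] is mapped
    onto it. *)

Set Implicit Arguments.
Unset Strict Implicit.
Unset Printing Implicit Defensive.

Import Order.TTheory.
Local Open Scope order_scope.

(** * Isomorphisms and involutions of universes *)

Lemma universe_isomorphic_sym d d' (U : universeType d) (U' : universeType d') :
  universe_isomorphic U U' -> universe_isomorphic U' U.
Proof. by case=> f [g [fK gK fm gm]]; exists g, f. Qed.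

Lemma bij_morphism_isomorphic d d' (U : universeType d) (U' : universeType d')
    (f : U -> U') :
  bijective f -> universe_morphism f -> universe_isomorphic U U'.
Proof.
case=> g fK gK fm; exists f, g; split=> //; case: fm => fV fJ fM.
split=> [x|x y|x y]; apply: (can_inj fK).
- by rewrite gK fV gK.
- by rewrite gK fJ !gK.
- by rewrite gK fM !gK.
Qed.

Lemma inj_surj_bij (T T' : Type) (f : T -> T') :
  injective f -> (forall y, exists x, f x = y) -> bijective f.
Proof.
move=> f_inj /choice[g gK]; exists g => // x.
by apply: f_inj; rewrite gK.
Qed.

Section UniverseTheory.
Variables (d : Order.disp_t) (U : universeType d).
Implicit Types x y : U.

Lemma sinv_le x y : (sinv x <= sinv y) = (y <= x).
Proof.
by apply/idP/idP => /le_sinv //; rewrite !sinvK.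
Qed.

Lemma le_sinvC x y : (x <= sinv y) = (y <= sinv x).
Proof. by rewrite -[in RHS]sinv_le sinvK. Qed.

Lemma sinv_join x y : sinv (x `|` y) = sinv x `&` sinv y.
Proof.
apply/le_anti/andP; split; first by rewrite lexI !sinv_le leUl leUr.
by rewrite le_sinvC leUx le_sinvC leIl le_sinvC leIr.
Qed.

Lemma sinv_meet x y : sinv (x `&` y) = sinv x `|` sinv y.
Proof. by rewrite -[RHS]sinvK sinv_join !sinvK. Qed.

End UniverseTheory.

Lemma universe_morphism_le d d' (U : universeType d) (U' : universeType d')
    (f : U -> U') :
  injective f -> universe_morphism f -> {mono f : x y / x <= y}.
Proof.
move=> f_inj [_ _ fM] x y.
by rewrite !leEmeet -fM (inj_eq f_inj).
Qed.

(** * Extremal elements in a finite lattice *)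

Section FinLatticeExtrema.
Variables (d : Order.disp_t) (L : finLatticeType d) (P : pred L) (x0 : L).
Hypothesis Px0 : P x0.

Lemma join_closed_greatest :
  (forall x y, P x -> P y -> P (x `|` y)) ->
  exists2 u, P u & forall w, P w -> w <= u.
Proof.
(* The fold starts at [x0] since a bottom element need not satisfy [P]. *)
move=> PJ; exists (foldr Order.join x0 (filter P (enum L))).
  have: all P (filter P (enum L)) by apply: filter_all.
  by elim: filter => //= x s IHs /andP[Px /IHs]; apply: PJ.
move=> w Pw; have: w \in filter P (enum L) by rewrite mem_filter Pw mem_enum.
elim: filter => //= x s IHs; rewrite inE => /predU1P[<-|/IHs ws].
  exact: leUl.
by rewrite lexU2 ?ws ?orbT.
Qed.

Lemma meet_closed_least :
  (forall x y, P x -> P y -> P (x `&` y)) ->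
  exists2 u, P u & forall w, P w -> u <= w.
Proof.
move=> PM; exists (foldr Order.meet x0 (filter P (enum L))).
  have: all P (filter P (enum L)) by apply: filter_all.
  by elim: filter => //= x s IHs /andP[Px /IHs]; apply: PM.
move=> w Pw; have: w \in filter P (enum L) by rewrite mem_filter Pw mem_enum.
elim: filter => //= x s IHs; rewrite inE => /predU1P[<-|/IHs ws].
  exact: leIl.
by rewrite leIx2 ?ws ?orbT.
Qed.

Lemma finite_minimal :
  exists2 u, u <= x0 /\ P u & forall w, P w -> w <= u -> w = u.
Proof.
pose Q u := (u <= x0) && P u.
have Qx0 : Q x0 by rewrite /Q lexx.
(* Fewer elements lie below [w] than below [u] once [w < u], so minimising this number gives a
   minimal element. *)
case: (@arg_minnP _ x0 Q (fun u => #|[pred w | w <= u]|) Qx0) => u /andP[ux Pu] umin.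
exists u => // w Pw wu; apply/eqP; move: (wu); rewrite le_eqVlt => /orP[//|ltwu].
have := umin w; rewrite /Q Pw (le_trans wu ux) => /(_ isT).
rewrite leqNgt => /negP[]; apply/proper_card/properP; split.
  by apply/fintype.subsetP => z; rewrite !inE => /le_trans; apply.
by exists u; rewrite !inE ?lexx // lt_geF.
Qed.

End FinLatticeExtrema.

(** * Small separations of a graph *)

Section GraphUniverse.
Variable G : graph.
Implicit Types s t : graphSep G.

Lemma graphSep_eq s t : s.1 = t.1 -> s.2 = t.2 -> s = t.
Proof.
move=> e1 e2; apply/val_inj/val_inj => /=.
by rewrite [LHS]surjective_pairing e1 e2 -surjective_pairing.
Qed.

Lemma graphSep_cover s (v : G) : s.1 v \/ s.2 v.
Proof. by rewrite -[_ \/ _]/((s.1 `|` s.2)%classic v) sepUT. Qed.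

Lemma graphSep_distributive : distributive_universe (graphSep G).
Proof. by move=> s t u; apply: graphSep_eq; [apply: setIUl | apply: setUIl]. Qed.

Fact setT_sep_subproof (A : set G) : `[< A `|` setT = setT >]%classic.
Proof. by apply/asboolP; rewrite setUT. Qed.

Fact setT_separates (A : set G) :
  separates (@SetSep G (A, setT) (setT_sep_subproof A)).
Proof. by apply/asboolP => x y /= [_ []]. Qed.

Definition small_sep (A : set G) : graphSep G := GraphSep (setT_separates A).

(** If [s.1] is contained in [s.2], then [s.2] is the union of both sides. So a small separation is
    determined by its first side. *)
Lemma small_sepP s : reflect (s.2 = setT)%classic (small s).
Proof.
apply: (iffP (asboolP _)) => /= [[s12 _]|->]; last by split; apply: subsetT.
by rewrite -(sepUT s) setUidr.
Qed.

Lemma small_sep_small (A : set G) : small (small_sep A).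
Proof. exact/small_sepP. Qed.

End GraphUniverse.

(** * Necessity of the conditions *)

Section GraphicImpliesBoolean.
Variables (d : Order.disp_t) (U : universeType d) (G : graph).
Hypothesis isoGU : universe_isomorphic (graphSep G) U.

Lemma graphic_distributive : distributive_universe U.
Proof.
case: isoGU => f [g [fK gK fm [_ gJ gM]]] x y z; apply: (can_inj gK).
by rewrite !(gJ, gM) graphSep_distributive.
Qed.

(** The small separations of [G] are the pairs (A, V) with A arbitrary, ordered by A, so [Small U]
    is a copy of the power set of [G]. *)
Lemma graphic_small_boolean : boolean_algebra (Small U).
Proof.
case: isoGU => f [g [fK gK fm gm]].
have f_le := universe_morphism_le (can_inj fK) fm.
have g_le := universe_morphism_le (can_inj gK) gm.
have [[fV _ _] [gV _ _]] := (fm, gm).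
have g_small (s : Small U) : ((g (small_val s)).2 = setT)%classic.
  by apply/small_sepP; rewrite /small -gV g_le; apply: small_valP.
have f_small (A : set G) : small (f (small_sep A)).
  by rewrite /small -fV f_le; apply: small_sep_small.
exists _, (set G), (fun s : Small U => (g (small_val s)).1); split.
  exists (fun A => MkSmall (f_small A)) => [s|A] /=; last by rewrite fK.
  apply: val_inj => /=; apply: (can_inj gK); rewrite fK.
  by apply: graphSep_eq; rewrite ?g_small.
move=> s t /=; transitivity (g (small_val s) <= g (small_val t)); last exact: g_le.
apply/idP/asboolP => [st|[st _]]; last by rewrite subsetEset.
split; first by rewrite -subsetEset.
by rewrite [X in (_ `<=` X)%classic]g_small; apply: subsetT.
Qed.

(** The image of (V, V) serves: swapping sides fixes it, and it lies above every (A, V). *)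
Lemma graphic_small_degenerate :
  exists m : Small U, greatest m /\ degenerate (small_val m).
Proof.
case: isoGU => f [g [fK gK fm gm]].
have [[fV _ _] [gV _ _]] := (fm, gm).
have g_le := universe_morphism_le (can_inj gK) gm.
have degm : degenerate (f (small_sep setT)).
  by rewrite /degenerate -fV; congr f; apply: graphSep_eq.
have smallm : small (f (small_sep setT)) by rewrite /small -degm.
exists (MkSmall smallm); split=> // s.
change (small_val s <= f (small_sep setT)); rewrite -g_le fK.
apply/asboolP; split; first exact: subsetT.
have -> : ((g (small_val s)).2 = setT)%classic.
  by apply/small_sepP; rewrite /small -gV g_le; apply: small_valP.
exact: subsetT.
Qed.

End GraphicImpliesBoolean.

(** * Sufficiency: atoms below the degenerate element [m] *)

Section BooleanImpliesGraphic.
Variables (d : Order.disp_t) (U : finUniverseType d) (m bot : U).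
Hypothesis distU : distributive_universe U.
Hypothesis degm : degenerate m.
Hypothesis smallm : forall x : U, small x -> x <= m.
Hypothesis le_bot : forall x : U, bot <= x.
Hypothesis complm : forall x : U, x <= m ->
  exists c : U, x `&` c = bot /\ x `|` c = m.
Implicit Types u v w x y : U.

Let meetUr x y z : x `&` (y `|` z) = (x `&` y) `|` (x `&` z).
Proof. by rewrite meetC distU meetC [z `&` x]meetC. Qed.

Let lexbot x : (x <= bot) = (x == bot).
Proof. by rewrite eq_le le_bot andbT. Qed.

Lemma le_m_join_sinv u : m <= u `|` sinv u.
Proof.
rewrite -sinv_le -degm sinv_join sinvK; apply: smallm.
by rewrite /small sinv_meet sinvK (le_trans (leIl _ _)) ?leUr.
Qed.

Definition atom v :=
  [&& v <= m, v != bot & [forall w, (w <= v) ==> (w == bot) || (w == v)]].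

(** By distributivity [v] is the join of its meets with [x] and [y]; these are not both [bot], and
    one that is not equals [v]. *)
Lemma atom_le_join v x y : atom v -> (v <= x `|` y) = (v <= x) || (v <= y).
Proof.
case/and3P=> _ v0 /forallP vP; apply/idP/orP => [|[vx|vy]]; last 2 first.
- by rewrite lexU2 ?vx.
- by rewrite lexU2 ?vy ?orbT.
rewrite leEmeet meetUr => /eqP ev.
have /implyP/(_ (leIl _ _))/orP[/eqP e|] := vP (v `&` x);
  last by rewrite -leEmeet; left.
have /implyP/(_ (leIl _ _))/orP[/eqP e'|] := vP (v `&` y);
  last by rewrite -leEmeet; right.
by move: v0; rewrite -ev e e' joinxx eqxx.
Qed.

Lemma exists_atom x : x <= m -> x != bot -> exists2 v, atom v & v <= x.
Proof.
move=> xm x0.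
have [v [vx v0] vP] := @finite_minimal _ _ (fun w => w != bot) _ x0.
exists v => //; apply/and3P; split=> //; first exact: le_trans xm.
apply/forallP => w; apply/implyP => wv.
by case: eqP => //= /eqP w0; apply/eqP/vP.
Qed.

(** Let [c] be the complement of [y] below [m]. An atom below both [x] and [c] would lie below [y]
    and [c], so [x] meets [c] in [bot] and lies below [y]. *)
Lemma le_atoms x y : x <= m -> y <= m ->
  (forall v, atom v -> v <= x -> v <= y) -> x <= y.
Proof.
move=> xm ym xy; have [c [yc0 ycm]] := complm ym.
have [xc0|xc0] := eqVneq (x `&` c) bot.
  rewrite -[leLHS](meet_idPl xm) -ycm meetUr xc0 leUx le_bot andbT.
  exact: leIr.
have [v va] := exists_atom (le_trans (leIl x c) xm) xc0.
rewrite lexI => /andP[vx vc].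
have /and3P[_ /negP[]] := va.
by rewrite -lexbot -yc0 lexI vc (xy v).
Qed.

(** Cancellation in distributive lattices: as [x] is below the join of [y] and [z], it is the join
    of its meets with them, both below [y]. *)
Lemma le_meet_join x y z : x `&` z <= y `&` z -> x `|` z <= y `|` z -> x <= y.
Proof.
move=> xyM xyJ; have xyz : x <= y `|` z by apply: le_trans xyJ; apply: leUl.
rewrite -[leLHS](meet_idPl xyz) meetUr leUx leIr /=.
by apply: le_trans xyM _; apply: leIl.
Qed.

(** * Atoms as vertices of a graph *)

Notation V := {v : U | atom v}.

(** The first hypothesis compares the meets with [m]; the second compares the joins with [m], since
    inverting these gives meets with [m] again. *)
Lemma le_sides x y :
  (forall v, atom v -> v <= x -> v <= y) ->
  (forall v, atom v -> v <= sinv y -> v <= sinv x) -> x <= y.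
Proof.
move=> xy yx; apply: (@le_meet_join _ _ m).
  apply: le_atoms; rewrite ?leIr // => v va.
  by rewrite !lexI => /andP[/(xy v va)-> ->].
rewrite -sinv_le !sinv_join -degm.
apply: le_atoms; rewrite ?leIr // => v va.
by rewrite !lexI => /andP[/(yx v va)-> ->].
Qed.

(** The largest edge relation for which every [u] yields a separation. The second condition holds
    trivially when [x = y], so loops are excluded separately. *)
Definition atom_edge (x y : V) := x <> y /\ forall u,
  ~ [/\ val x <= u, ~~ (val x <= sinv u), val y <= sinv u & ~~ (val y <= u)].

Fact atom_edge_sym (x y : V) : atom_edge x y -> atom_edge y x.
Proof.
case=> xy E; split=> [/esym//|u [yu ynu xu xnu]].
by apply: (E (sinv u)); rewrite sinvK.
Qed.

Fact atom_edge_irrefl (x : V) : ~ atom_edge x x.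
Proof. by case. Qed.

Definition atom_graph := Graph atom_edge_sym atom_edge_irrefl.

Fact atom_sep_subproof u :
  `[< [set v : V | val v <= u] `|` [set v : V | val v <= sinv u] = setT >]%classic.
Proof.
apply/asboolP/seteqP; split=> // v _; apply/orP.
rewrite -atom_le_join; last exact: valP.
by apply: le_trans (le_m_join_sinv u); case/and3P: (valP v).
Qed.

Definition atom_setSep u : setSep atom_graph :=
  @SetSep V (_, _) (atom_sep_subproof u).

Fact atom_separates u : separates (atom_setSep u).
Proof.
apply/asboolP => x y [/= xu /negP xnu] [/= yu /negP ynu] [_ E].
by apply: (E u); split.
Qed.

Definition atom_sep u : graphSep atom_graph := GraphSep (atom_separates u).

Lemma atom_sep_morphism : universe_morphism atom_sep.
Proof.
split=> [u|u w|u w]; apply: graphSep_eq => /=; apply/seteqP;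
  split=> v /=; rewrite ?sinvK ?sinv_join ?sinv_meet ?lexI
    ?(atom_le_join _ _ (valP v)) //;
  by [move/andP | move/orP | move=> ?; apply/andP | move=> ?; apply/orP].
Qed.

Lemma atom_sep_le u w : atom_sep u <= atom_sep w -> u <= w.
Proof.
by move=> /asboolP[/= uw wu]; apply: le_sides => v va;
  [apply: (uw (Sub v va)) | apply: (wu (Sub v va))].
Qed.

Lemma atom_sep_inj : injective atom_sep.
Proof. by move=> u w e; apply/le_anti; rewrite !atom_sep_le // e. Qed.

(** * Surjectivity onto the separations of the atom graph *)

Lemma atom_le_atom v w : atom v -> atom w -> v <= w -> v = w.
Proof.
move=> /and3P[_ v0 _] /and3P[_ _ /forallP/(_ v)/implyP wP] /wP.
by rewrite (negPf v0) => /eqP.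
Qed.

Lemma atom_le_sinv_atom v w : atom v -> atom w -> v <= sinv w.
Proof.
case/and3P=> vm _ _ /and3P[wm _ _]; apply: le_trans vm _.
by rewrite degm sinv_le.
Qed.

(** The image of an atom [v] is ({v}, V): distinct atoms are incomparable, and every atom is below
    [m], hence below the inverse of every atom. *)
Lemma atom_sep_atom_le (v : V) (s : graphSep atom_graph) :
  s.1 v -> atom_sep (val v) <= s.
Proof.
move=> sv; apply/asboolP; split=> w /= => [wv|_].
  suff -> : w = v by [].
  by apply: val_inj; apply: atom_le_atom wv; apply: valP.
by apply: atom_le_sinv_atom; apply: valP.
Qed.

(* The [w] below is the least element whose second side misses [y]; it lies
   below the inverses of the atoms in both sides of [s] and below the elements
   separating [y] from the vertices strictly on the second side. *)
Lemma exists_atom_sep_le (y : V) (s : graphSep atom_graph) :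
  ~ s.2 y -> exists2 w, atom_sep w <= s & ~~ (val y <= sinv w).
Proof.
move=> ys2; have /and3P[_ y0 _] := valP y.
have ys1 : s.1 y by case: (graphSep_cover s y).
pose P w := ~~ (val y <= sinv w).
have Ptop : P (sinv bot) by rewrite /P sinvK lexbot.
have PM w w' : P w -> P w' -> P (w `&` w').
  by rewrite /P sinv_meet (atom_le_join _ _ (valP y)) negb_or => -> ->.
have [w yw wmin] := meet_closed_least Ptop PM.
have sep (z : V) : s.2 z -> ~ s.1 z -> val z <= sinv w /\ ~~ (val z <= w).
  move=> zs2 zs1; have : ~ atom_edge y z.
    by move: (gsepP s) => /asboolP; apply.
  move=> /not_andP[/contrapT eyz|/existsNP[u /contrapT[_ ynu zu znu]]].
    by case: zs1; rewrite -eyz.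
  have wu := wmin _ ynu.
  split; first by rewrite (le_trans zu) // sinv_le.
  by apply: contra znu => /le_trans; apply.
exists w => //; apply/asboolP; split=> z.
  move=> /= zw; apply: contrapT => zs1.
  have zs2 : s.2 z by case: (graphSep_cover s z).
  by have [_ /negP] := sep z zs2 zs1.
move=> zs2; change (val z <= sinv w).
have [zs1|/(sep z zs2)[]//] := pselect (s.1 z).
rewrite le_sinvC; apply: wmin; rewrite /P sinvK.
apply/negP => /(atom_le_atom (valP y) (valP z))/val_inj eyz.
by case: ys2; rewrite eyz.
Qed.

(** For the greatest [u] mapped below [s], each atom in [s.1] is itself mapped below [s], hence is
    below [u]. An atom [v] below [sinv u] but outside [s.2] would give some [w <= u] with [v] not
    below [sinv w], although [sinv u <= sinv w]. *)
Lemma atom_sep_surj (s : graphSep atom_graph) : exists u, atom_sep u = s.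
Proof.
have [_ fJ _] := atom_sep_morphism.
have Pbot : atom_sep bot <= s.
  apply/asboolP; split=> v /=; last first.
    by rewrite le_sinvC le_bot.
  by rewrite lexbot; case/and3P: (valP v) => _ /negPf->.
have PJ u w : atom_sep u <= s -> atom_sep w <= s -> atom_sep (u `|` w) <= s.
  by rewrite fJ leUx => -> ->.
have [u us umax] :=
  join_closed_greatest (P := fun u => atom_sep u <= s) Pbot PJ.
exists u; apply/le_anti; rewrite us /=; apply/asboolP; split=> v.
  by move=> /atom_sep_atom_le/umax.
move=> vu; apply: contrapT => /exists_atom_sep_le[w /umax wu /negP[]].
by apply: le_trans vu _; rewrite sinv_le.
Qed.

Lemma boolean_graphic_implementation : graphic_implementation U.
Proof.
exists atom_graph; apply: universe_isomorphic_sym.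
apply: bij_morphism_isomorphic atom_sep_morphism.
exact: inj_surj_bij atom_sep_inj atom_sep_surj.
Qed.

End BooleanImpliesGraphic.

Theorem theorem4p2 (d : Order.disp_t) (U : finUniverseType d) :
  graphic_implementation U <->
  distributive_universe U /\
  boolean_algebra (Small U) /\
  exists m : Small U, greatest m /\ degenerate (small_val m).
Proof.
split=> [[G isoGU]|[distU [boolU [m [gm degm]]]]].
  split; [exact: graphic_distributive isoGU | split].
    exact: graphic_small_boolean isoGU.
  exact: graphic_small_degenerate isoGU.
have smallm x : small x -> x <= small_val m.
  by move=> xs; apply: (gm (MkSmall xs)).
have small_le x : x <= small_val m -> small x.
  by move=> xm; rewrite /small (le_trans xm) // degm le_sinv.
(* The least element of [U] is the meet of all its elements. *)
have [bot _ /(_ _ isT) le_bot] :=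
  meet_closed_least (P := predT) (x0 := small_val m) isT (fun _ _ _ _ => isT).
apply: (boolean_graphic_implementation distU degm smallm le_bot) => x xm.
case: boolU => d' [B [f [[g fK gK] f_le]]].
(* The complement is taken in [B] and pulled back along [f]. *)
pose s := MkSmall (small_le x xm); pose c := g (~` f s).
have cm : small_val c <= small_val m by apply: gm.
exists (small_val c); split; apply/le_anti/andP; split.
- have smallI : small (x `&` small_val c) by rewrite small_le // leIx2 ?xm.
  have smallb : small bot by rewrite small_le.
  (* Since [f] is only known to preserve order, the meet is treated as a common lower bound: its
     image is below [f s] and its complement, hence below the bottom of [B]. The join is handled
     dually. *)
  suff : MkSmall smallI <= MkSmall smallb by [].
  rewrite -f_le (le_trans _ (le0x _)) //.
  rewrite -(Order.CTBDistrLatticeTheory.meetxC (f s)) lexI -[~` f s]gK.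
  by rewrite !f_le; apply/andP; split; [apply: leIl | apply: leIr].
- exact: le_bot.
- by rewrite leUx xm cm.
have smallU : small (x `|` small_val c) by rewrite small_le // leUx xm cm.
suff : m <= MkSmall smallU by [].
rewrite -f_le (le_trans (lex1 _)) //.
rewrite -(Order.CTBDistrLatticeTheory.joinxC (f s)) leUx -[~` f s]gK.
by rewrite !f_le; apply/andP; split; [apply: leUl | apply: leUr].
Qed.
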